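(* Let $\mathbb F_q$ be a finite field, let $n$ and $k$ be positive integers such that $n>k$, let $A=\{a_1,\ldots,a_n\}\subset\mathbb F_q$ be a set of $n$ distinct elements, and let $\mathbf 1=(1,1,\ldots,1)\in\mathbb F_q^n$. Then $\mathcal C(A,k,\mathbf 1)$ is either MDS or NMDS, depending on the following: (1) $\mathcal C(A,k,\mathbf 1)$ is MDS if and only if $A$ is $k$-zero-sum free. (2) $\mathcal C(A,k,\mathbf 1)$ is NMDS if and only if $A$ contains a zero-sum subset of size $k$.
   Context: $\mathbb F_q$ is the finite field with $q$ elements and $\mathbb F_q^*=\mathbb F_q\setminus\{0\}$. A $q$-ary $[n,k,d]$-linear code is a subspace $\mathcal C$ of $\mathbb F_q^n$ of dimension $k$ and minimum (Hamming) distance $d$. Its dual is $\mathcal C^{\bot}=\{b\in\mathbb F_q^n : \sum_{i=1}^n a_ib_i=0 \text{ for all } a\in\mathcal C\}$. An $[n,k,d]$-linear code is MDS if $d=n-k+1$ and AMDS if $d=n-k$. An AMDS code $\mathcal C$ is NMDS if $\mathcal C^{\bot}$ is also AMDS. The code $\mathcal C(A,k,\lambda)$: for positive integers $n>k$, a set $A=\{a_1,\ldots,a_n\}\subset\mathbb F_q$ of $n$ distinct elements, and $\lambda=(\lambda_1,\ldots,\lambda_n)$ with all $\lambda_i\in\mathbb F_q^*$, $\mathcal C(A,k,\lambda)$ is the $q$-ary linear code of length $n$ generated by the $k$ rows $(\lambda_1a_1^j,\lambda_2a_2^j,\ldots,\lambda_na_n^j)$ with exponents $j=k,\,k-2,\,k-3,\ldots,1,0$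 (i.e. $j\in\{k\}\cup\{0,1,\ldots,k-2\}$; the exponent $k-1$ is omitted; $a^0=1$ for every $a\in\mathbb F_q$). A finite subset of $\mathbb F_q$ is zero-sum if the sum of its elements is $0$. The set $A$ is $k$-zero-sum free if $A$ contains no zero-sum subset of size $k$. *)

(* Defs.v *)
From HB Require Import structures.
From mathcomp Require Import all_boot all_order all_algebra.

Set Implicit Arguments.
Unset Strict Implicit.
Unset Printing Implicit Defensive.

Import GRing.Theory.
Local Open Scope ring_scope.

Section Codes.

Variables (F : finFieldType) (n : nat).
Implicit Types (u v a b : 'rV[F]_n) (C : {vspace 'rV[F]_n}) (d : nat).

Definition hamming_dist u v : nat := #|[set i | u 0 i != v 0 i]|.

(* A relation rather than a function: the zero code has no minimum distance. *)
Definition has_min_dist C d : Prop :=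
  (exists u v, [/\ u \in C, v \in C, u != v & hamming_dist u v = d]) /\
  (forall u v, u \in C -> v \in C -> u != v -> (d <= hamming_dist u v)%N).

Definition dot u v : F := \sum_(i < n) u 0 i * v 0 i.

(* The vectors orthogonal to C already form a subspace, so taking their span
   adds nothing; see mem_dual_code. *)
Definition dual_code C : {vspace 'rV[F]_n} :=
  <<enum [pred b | [forall (a | a \in C), dot a b == 0%R]]>>%VS.

Lemma mem_dual_code C b :
  reflect (forall a, a \in C -> dot a b = 0)
          (b \in dual_code C).
Proof.
apply: (iffP idP) => [bC a aC | bC]; last first.
  apply: memv_span; rewrite mem_enum inE.
  by apply/forall_inP => a aC; apply/eqP/bC.
rewrite (coord_span bC) /dot.
under eq_bigr do rewrite summxE mulr_sumr.
rewrite exchange_big big1 //= => j _.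
under eq_bigr do rewrite mxE mulrCA.
rewrite -mulr_sumr.
set e := enum _; have : e`_j \in e by rewrite mem_nth // -cardE.
rewrite mem_enum inE => /forall_inP jC.
by move/eqP: (jC a aC) => ->; rewrite mulr0.
Qed.

(* The subtractions do not truncate, since \dim C <= n. *)
Definition MDS C : Prop := has_min_dist C (n - \dim C + 1).
Definition AMDS C : Prop := has_min_dist C (n - \dim C).
Definition NMDS C : Prop := AMDS C /\ AMDS (dual_code C).

(* The code C(A, k, lam) for A = {a_i}: its exponents are k and 0, ..., k - 2
   (only k when k = 1). *)
Definition evaluation_code (a : 'I_n -> F) (k : nat) (lam : 'I_n -> F) :
    {vspace 'rV[F]_n} :=
  <<[seq \row_(i < n) (lam i * a i ^+ j)%R | j <- k :: iota 0 k.-1]>>%VS.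

End Codes.

Definition zero_sum (F : finFieldType) (S : {set F}) : Prop :=
  \sum_(x in S) x = 0.

Definition zero_sum_free (F : finFieldType) (k : nat) (A : {set F}) : Prop :=
  ~ exists S : {set F}, [/\ S \subset A, #|S| = k & zero_sum S].

(* Main.v *)
Require Import Defs.
From HB Require Import structures.
From mathcomp Require Import all_boot all_order all_algebra.

Set Implicit Arguments.
Unset Strict Implicit.
Unset Printing Implicit Defensive.

Import GRing.Theory.
Local Open Scope ring_scope.

(** The codewords are the evaluations on A of the polynomials p of degree at
    most k without term of degree k - 1. A nonzero p has at most k roots, and if
    it has k roots in A then these roots have sum 0, by Vieta; conversely every
    zero-sum k-subset of A is the root set of such a p. This settles the minimum
    distance of the code. In the dual, a nonzero word b has weight at least k:
    otherwise, the product of the X - a_j over the j in the support of b other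
    than i has degree at most k - 2, and orthogonality gives b_i = 0. If some
    nonzero codeword c vanishes on a set J of k positions, then the space W of
    words supported on J meets the dual nontrivially: otherwise their direct sum
    would be the whole space by dimensions, whereas c is orthogonal to both. *)

(** * Weights and duals of arbitrary linear codes *)

Section LinearCodes.

Variables (F : finFieldType) (n : nat).
Implicit Types (u v w b : 'rV[F]_n) (C : {vspace 'rV[F]_n}) (J : {set 'I_n}).

Definition weight w : nat := #|[set i | w 0 i != 0]|.

Lemma hamming_distE u v : hamming_dist u v = weight (u - v).
Proof. by apply: eq_card => i; rewrite !inE !mxE subr_eq0. Qed.

Lemma weight_zeros w : (weight w + #|[set i | w 0%R i == 0%R]| = n)%N.
Proof.
rewrite -[RHS]card_ord -(cardC (mem [set i | w 0 i != 0])); congr addn.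
by apply: eq_card => i; rewrite !inE negbK.
Qed.

Lemma has_min_distP C d :
  has_min_dist C d <->
  (exists w, [/\ w \in C, w != 0 & weight w = d]) /\
  (forall w, w \in C -> w != 0 -> (d <= weight w)%N).
Proof.
split=> [[[u [v [uC vC uv duv]]] le_d] | [[w [wC w0 dw]] le_d]]; split.
- by exists (u - v); rewrite memvB // subr_eq0 uv -hamming_distE.
- by move=> w wC w0; rewrite -[w]subr0 -hamming_distE le_d ?mem0v.
- by exists w, 0; rewrite wC mem0v w0 hamming_distE subr0.
- by move=> u v uC vC uv; rewrite hamming_distE le_d ?memvB ?subr_eq0.
Qed.

Lemma dotC u v : dot u v = dot v u.
Proof. by apply: eq_bigr => i _; rewrite mulrC. Qed.

Lemma dotDr u v w : dot u (v + w) = dot u v + dot u w.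
Proof.
by rewrite /dot -big_split; apply: eq_bigr => i _; rewrite mxE mulrDr.
Qed.

Lemma dot_delta u i : dot u (delta_mx 0 i) = u 0 i.
Proof.
rewrite /dot (bigD1 i) //= mxE !eqxx mulr1 big1 ?addr0 // => j ji.
by rewrite mxE (negPf ji) andbF mulr0.
Qed.

(** The dual is the kernel of [f], which pairs a word with each basis vector of [C]. Independence of
    the rows of [B] makes [f] surjective, and rank-nullity concludes. *)
Lemma dim_dual_code C : \dim (dual_code C) = (n - \dim C)%N.
Proof.
set m := \dim C.
pose B : 'M[F]_(m, n) := \matrix_(i < m) (vbasis C)`_i.
have rowB i : row i B = (vbasis C)`_i by rewrite rowK.
have freeB : row_free B.
  apply: inj_row_free => v /=; rewrite mulmx_sum_row => vB.
  apply/rowP => i; rewrite mxE.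
  have /freeP := basis_free (vbasisP C); apply.
  by rewrite -[RHS]vB; apply: eq_bigr => j _; rewrite rowB.
have [E EB] : exists E, E *m B^T = 1%:M.
  by apply/row_fullP; rewrite /row_full mxrank_tr.
pose f : 'Hom('rV[F]_n, 'rV[F]_m) := linfun (mulmxr B^T).
have fE b i : f b 0 i = dot (vbasis C)`_i b.
  rewrite lfunE /= mxE dotC; apply: eq_bigr => j _.
  by rewrite -rowB !mxE.
have -> : dual_code C = lker f.
  apply/vspaceP => b; rewrite memv_ker.
  apply/mem_dual_code/eqP => [bC | fb0 u uC].
    apply/rowP => i; rewrite fE mxE bC //.
    by rewrite vbasis_mem // mem_nth // size_tuple.
  rewrite (coord_vbasis uC) dotC.
  elim/big_ind: _ => [|x y Dx Dy|i _].
  - by rewrite /dot big1 // => j _; rewrite mxE mulr0.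
  - by rewrite dotDr Dx Dy addr0.
  - rewrite /dot; under eq_bigr do rewrite mxE mulrCA.
    by rewrite -mulr_sumr -/(dot _ _) dotC -fE fb0 mxE mulr0.
have fT : limg f = fullv.
  apply/vspaceP => v; rewrite memvf; apply/memv_imgP.
  by exists (v *m E); rewrite ?memvf // lfunE /= -mulmxA EB mulmx1.
have := limg_ker_dim f fullv.
by rewrite capfv fT !dimvf /dim /= !mul1n => /(canRL (addnK m)).
Qed.

Lemma dual_code_low_weight C J c :
  c \in C -> c != 0 -> (\dim C <= #|J|)%N -> (forall i, i \in J -> c 0 i = 0) ->
  exists2 b, b \in dual_code C & b != 0 /\ (weight b <= #|J|)%N.
Proof.
move=> cC c0 dimC cJ.
(* Writing [W] as the dual of the unit vectors outside [J] lets [dim_dual_code] bound its dimension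
   without a basis. *)
pose W : {vspace 'rV[F]_n} :=
  dual_code <<[seq (delta_mx 0 i)%R | i in ~: J]>>%VS.
have W_supp b i : b \in W -> i \notin J -> b 0 i = 0.
  move/mem_dual_code => bW iJ; rewrite -dot_delta dotC; apply: bW.
  by apply/memv_span/imageP; exists i; rewrite ?inE.
have Jn : (#|J| <= n)%N by rewrite -[leqRHS]card_ord max_card.
have dimW : (#|J| <= \dim W)%N.
  rewrite dim_dual_code -(subKn Jn) leq_sub2l // (leq_trans (dim_span _)) //.
  by rewrite size_image [leqLHS]cardsCs setCK card_ord.
have [WD0 | WDn0] := eqVneq (W :&: dual_code C)%VS 0%VS.
  have sumT : (W + dual_code C)%VS = fullv.
    apply/eqP; rewrite eqEdim subvf (dimv_disjoint_sum WD0) dimvf /dim /=.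
    rewrite mul1n (dim_dual_code C) addnC -leq_subLR.
    by rewrite subKn ?(leq_trans dimC).
  (* Splitting each unit vector along the sum shows [c] orthogonal to it: on [W], because [c]
     vanishes on [J] and [u] vanishes off [J]. *)
  case/eqP: c0; apply/rowP => i; rewrite mxE -dot_delta.
  have /memv_addP[u uW [v vD ->]] : delta_mx 0 i \in (W + dual_code C)%VS.
    by rewrite sumT memvf.
  rewrite dotDr (mem_dual_code _ _ vD) // addr0 /dot big1 // => j _.
  by have [/cJ->|/(W_supp _ _ uW)->] := boolP (j \in J); rewrite ?mul0r ?mulr0.
have := memv_pick (W :&: dual_code C)%VS; rewrite memv_cap => /andP[bW bD].
exists (vpick (W :&: dual_code C)%VS) => //; rewrite vpick0; split=> //.
apply/subset_leq_card/subsetP => i; rewrite inE; apply: contraNT => iJ.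
by rewrite (W_supp _ _ bW iJ).
Qed.

Lemma MDS_not_AMDS C : MDS C -> ~ AMDS C.
Proof.
case=> _ ge [[u [v [uC vC uv duv]]] _].
by have := ge u v uC vC uv; rewrite duv addn1 ltnn.
Qed.

End LinearCodes.

(** The roots exhaust the degree, so [p] is a nonzero multiple of the product of the [X - r], whose
    coefficient just below the top is minus the sum of the roots. *)
Lemma Vieta_sum_roots (F : fieldType) (p : {poly F}) (rs : seq F) :
  p != 0 -> all (root p) rs -> uniq rs -> (0 < size rs)%N ->
  (size p <= (size rs).+1)%N -> p`_(size rs).-1 = 0 -> \sum_(r <- rs) r = 0.
Proof.
move=> p0 rts urs rs0 sp pk.
have {}sp : size p = (size rs).+1.
  by apply/eqP; rewrite eqn_leq sp max_poly_roots.
have := all_roots_prod_XsubC sp rts; rewrite uniq_rootsE => /(_ urs) pE.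
move: pk; rewrite {}pE coefZ coefPn_prod_XsubC -?lt0n // => /eqP.
by rewrite mulf_eq0 lead_coef_eq0 (negPf p0) oppr_eq0 => /eqP.
Qed.

(** * Codewords as evaluations of polynomials *)

Section EvaluationCode.

Variables (F : finFieldType) (n k : nat) (a : 'I_n -> F).
Hypotheses (k_gt0 : (0 < k)%N) (k_lt_n : (k < n)%N) (a_inj : injective a).
Implicit Types (p : {poly F}) (rs : seq F).

Definition eval_word p : 'rV[F]_n := \row_i p.[a i].

Let C := evaluation_code a k (fun=> 1).

(** This covers [k = 1] as well: the list is then [[:: 1]] and the gap is at [0]. *)
Lemma gap_exponents j :
  (j \in k :: iota 0 k.-1) = (j <= k)%N && (j != k.-1).
Proof.
rewrite inE mem_iota add0n; case: k k_gt0 => // m _ /=.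
rewrite (leq_eqVlt _ m.+1) ltnS.
by case: ltngtP => [||->]; rewrite ?andbT // (ltn_eqF (ltnSn m)).
Qed.

Lemma uniq_gap_exponents : uniq (k :: iota 0 k.-1).
Proof. by rewrite /= iota_uniq mem_iota andbT add0n -leqNgt leq_pred. Qed.

Lemma eval_wordZXn c j :
  eval_word (c *: 'X^j) = c *: \row_(i < n) (1 * a i ^+ j).
Proof. by apply/rowP => i; rewrite !mxE hornerZ hornerXn mul1r. Qed.

Lemma eval_word_sum (I : Type) (r : seq I) (P : I -> {poly F}) :
  eval_word (\sum_(i <- r) P i) = \sum_(i <- r) eval_word (P i).
Proof.
apply/rowP => i; rewrite summxE mxE horner_sum.
by apply: eq_bigr => j _; rewrite mxE.
Qed.

Lemma mem_evaluation_code p :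
  (size p <= k.+1)%N -> p`_k.-1 = 0 -> eval_word p \in C.
Proof.
move=> sp pk; rewrite -(coefK p) poly_def eval_word_sum.
apply: memv_suml => j _; rewrite eval_wordZXn.
have [->|jk] := eqVneq (nat_of_ord j) k.-1; first by rewrite pk scale0r mem0v.
apply/memvZ/memv_span/mapP; exists (nat_of_ord j) => //.
by rewrite gap_exponents jk andbT -ltnS (leq_trans _ sp).
Qed.

(** * Coordinates in the generators and dimension of the code *)

Lemma size_exponents : size (k :: iota 0 k.-1) = k.
Proof. by rewrite /= size_iota prednK. Qed.

(** Numbered like the generators, so that [coord generators] supplies polynomial coefficients. *)
Definition exponent (j : 'I_k) : nat := nth 0%N (k :: iota 0 k.-1) j.

Lemma exponentP j : (exponent j <= k)%N && (exponent j != k.-1).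
Proof. by rewrite -gap_exponents mem_nth ?size_exponents. Qed.

Lemma exponent_inj : injective exponent.
Proof.
move=> i j /eqP; rewrite nth_uniq ?size_exponents ?uniq_gap_exponents //.
by move/eqP/val_inj.
Qed.

Lemma size_generators :
  size [seq \row_(i < n) ((fun=> 1) i * a i ^+ j) | j <- k :: iota 0 k.-1] == k.
Proof. by rewrite size_map size_exponents. Qed.

Let generators := Tuple size_generators.

Definition gap_poly (c : 'I_k -> F) : {poly F} :=
  \sum_(j < k) c j *: 'X^(exponent j).

Lemma eval_gap_poly c :
  eval_word (gap_poly c) = \sum_(j < k) c j *: generators`_j.
Proof.
rewrite eval_word_sum; apply: eq_bigr => j _.
by rewrite eval_wordZXn (nth_map 0%N) ?size_exponents.
Qed.

Lemma coef_gap_poly c l :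
  (gap_poly c)`_l = \sum_(j < k) c j * (l == exponent j)%:R.
Proof. by rewrite coef_sum; apply: eq_bigr => j _; rewrite coefZ coefXn. Qed.

Lemma size_gap_poly c : (size (gap_poly c) <= k.+1)%N.
Proof.
apply/leq_sizeP => l kl; rewrite coef_gap_poly big1 // => j _.
have /andP[jk _] := exponentP j.
by rewrite gtn_eqF ?mulr0 // (leq_ltn_trans jk).
Qed.

Lemma coef_gap_poly_pred c : (gap_poly c)`_k.-1 = 0.
Proof.
rewrite coef_gap_poly big1 // => j _.
have /andP[_ jk] := exponentP j.
by rewrite eq_sym (negPf jk) mulr0.
Qed.

Lemma evaluation_codeP v :
  v \in C ->
  exists p, [/\ (size p <= k.+1)%N, p`_k.-1 = 0 & v = eval_word p].
Proof.
move=> vC; exists (gap_poly (fun j => coord generators j v)).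
by rewrite size_gap_poly coef_gap_poly_pred eval_gap_poly -coord_span.
Qed.

Lemma eval_word_zeros p :
  p != 0 -> (#|[set i | eval_word p 0%R i == 0%R]| < size p)%N.
Proof.
move=> p0; set Z := [set i | _].
have -> : #|Z| = size [seq a i | i in Z] by rewrite size_image.
apply: max_poly_roots => //; last by rewrite map_inj_uniq // enum_uniq.
by apply/allP => _ /imageP[i iZ ->]; move: iZ; rewrite inE mxE.
Qed.

Lemma eval_word_neq0 p : p != 0 -> (size p <= k.+1)%N -> eval_word p != 0.
Proof.
move=> p0 sp; apply/eqP => ev0; have := eval_word_zeros p0.
have -> : #|[set i | eval_word p 0 i == 0]| = n.
  by rewrite -[RHS]card_ord; apply: eq_card => i; rewrite ev0 !inE mxE eqxx.
by rewrite ltnNge (leq_trans sp).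
Qed.

(** A relation between the generators is a polynomial of degree at most [k] vanishing at [n > k]
    points, hence zero; its exponents being distinct, all its coefficients vanish. *)
Lemma dim_evaluation_code : \dim C = k.
Proof.
suff /eqP : free generators by rewrite size_tuple.
apply/freeP => c c0 i; have [g0 | gn0] := eqVneq (gap_poly c) 0; last first.
  have := eval_word_neq0 gn0 (size_gap_poly c).
  by rewrite eval_gap_poly c0 eqxx.
have := coef_gap_poly c (exponent i); rewrite g0 coef0 (bigD1 i) //= eqxx mulr1.
rewrite big1 ?addr0 // => j ji.
by rewrite (inj_eq exponent_inj) eq_sym (negPf ji) mulr0.
Qed.

(** * Minimum distance of the evaluation code *)

Lemma evaluation_code_weight w : w \in C -> w != 0 -> (n - k <= weight w)%N.
Proof.
case/evaluation_codeP=> p [sp pk ->] w0.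
have p0 : p != 0.
  by apply: contraNneq w0 => ->; apply/eqP/rowP => i; rewrite !mxE horner0.
rewrite leq_subLR -{1}(weight_zeros (eval_word p)) addnC leq_add2r.
by rewrite -ltnS (leq_trans (eval_word_zeros p0)).
Qed.

Lemma evaluation_code_zero_sum w :
  w \in C -> w != 0 -> (weight w <= n - k)%N ->
  exists S : {set F},
    [/\ S \subset [set a i | i : 'I_n], #|S| = k & zero_sum S].
Proof.
case/evaluation_codeP=> p [sp pk ->] w0 ww.
have p0 : p != 0.
  by apply: contraNneq w0 => ->; apply/eqP/rowP => i; rewrite !mxE horner0.
set Z := [set i | eval_word p 0 i == 0].
have cZ : #|Z| = k.
  apply/eqP; rewrite eqn_leq -ltnS (leq_trans (eval_word_zeros p0)) //=.
  move: ww; rewrite leq_subRL ?(ltnW k_lt_n) // addnC.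
  by rewrite -[leqRHS](weight_zeros (eval_word p)) leq_add2l.
exists (a @: Z); split.
- by apply/subsetP => _ /imsetP[i _ ->]; apply: imset_f.
- by rewrite card_imset.
rewrite /zero_sum -big_enum.
have sS : size (enum (a @: Z)) = k by rewrite -cardE card_imset.
apply: (Vieta_sum_roots p0); rewrite ?sS ?enum_uniq //.
apply/allP => x; rewrite mem_enum => /imsetP[i iZ ->].
by move: iZ; rewrite inE mxE.
Qed.

(** The zero sum is exactly the vanishing of the coefficient of degree [k - 1] in the product of the
    [X - r]. *)
Lemma prod_XsubC_word rs :
  size rs = k -> \sum_(r <- rs) r = 0 ->
  exists w, [/\ w \in C, w != 0 & forall i, a i \in rs -> w 0 i = 0].
Proof.
move=> srs rs0; pose p := \prod_(r <- rs) ('X - r%:P).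
have sp : size p = k.+1 by rewrite size_prod_XsubC srs.
exists (eval_word p); split.
- apply: mem_evaluation_code; first by rewrite sp.
  by rewrite -srs coefPn_prod_XsubC ?rs0 ?oppr0 // srs -lt0n.
- by apply: eval_word_neq0; rewrite ?sp // -size_poly_gt0 sp.
- by move=> i irs; rewrite mxE; apply/rootP; rewrite root_prod_XsubC.
Qed.

Lemma evaluation_code_low_weight :
  exists w, [/\ w \in C, w != 0 & (weight w <= n - k + 1)%N].
Proof.
have k1n : (k.-1 <= n)%N by rewrite (leq_trans (leq_pred _)) // ltnW.
pose J := take k.-1 (enum 'I_n).
have sJ : size J = k.-1 by rewrite size_takel // size_enum_ord.
(* The extra root is chosen to make the sum zero. It may lie outside A or repeat another root, so
   only [k - 1] zeros are counted. *)
have [||w [wC w0 wJ]] :=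
    @prod_XsubC_word (- (\sum_(i <- J) a i) :: map a J).
- by rewrite /= size_map sJ prednK.
- by rewrite big_cons big_map addNr.
exists w; split=> //.
rewrite addn1 -subSn ?(ltnW k_lt_n) // -(prednK k_gt0) subSS leq_subRL //.
rewrite -[leqRHS](weight_zeros w) addnC leq_add2l -sJ.
have uJ : uniq J by rewrite take_uniq // enum_uniq.
rewrite -(card_uniqP uJ); apply/subset_leq_card/subsetP => i iJ.
by rewrite inE wJ // inE map_f ?orbT.
Qed.

(** * Minimum distance of the dual *)

Lemma dual_evaluation_code_weight b :
  b \in dual_code C -> b != 0 -> (k <= weight b)%N.
Proof.
move/mem_dual_code => bC; apply: contraNT; rewrite -ltnNge => wb.
apply/eqP/rowP => i; rewrite mxE; apply/eqP; apply: contraTT isT => bi.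
pose T := [set j | b 0 j != 0] :\ i.
have sT : (size [seq a j | j in T]).+1 = weight b.
  by rewrite size_image /weight (cardsD1 i [set j | _]) inE bi.
pose p := \prod_(r <- [seq a j | j in T]) ('X - r%:P).
have sp : size p = weight b by rewrite size_prod_XsubC sT.
have pC : eval_word p \in C.
  apply: mem_evaluation_code; first by rewrite sp ltnW // ltnW.
  (* Since [weight b < k], the index [k.-1] lies beyond the degree of [p]. *)
  by rewrite nth_default // sp; case: k k_gt0 wb.
(* Only the term at [i] survives: elsewhere [b] or [p] vanishes, while [a i] is not a root of [p] as
   [a] is injective. *)
have /eqP := bC _ pC; rewrite /dot (bigD1 i) //= big1 => [|j ji].
  rewrite addr0 mulf_eq0 (negPf bi) orbF mxE -/(root p _) root_prod_XsubC.
  by rewrite mem_image // !inE eqxx.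
have [->|bj] := eqVneq (b 0 j) 0; first by rewrite mulr0.
rewrite mxE; apply/eqP; rewrite mulf_eq0 -/(root p _) root_prod_XsubC.
by rewrite mem_image // !inE ji bj.
Qed.

(** * The MDS and NMDS cases *)

Lemma MDS_evaluation_code :
  zero_sum_free k [set a i | i : 'I_n] -> MDS C.
Proof.
move=> zsf; rewrite /MDS dim_evaluation_code.
have ge w : w \in C -> w != 0 -> (n - k + 1 <= weight w)%N.
  move=> wC w0; rewrite addn1 ltnNge; apply/negP => ww.
  exact/zsf/(evaluation_code_zero_sum wC w0).
apply/has_min_distP; split=> //.
have [w [wC w0 ww]] := evaluation_code_low_weight.
by exists w; split=> //; apply/eqP; rewrite eqn_leq ww ge.
Qed.

Lemma NMDS_evaluation_code (S : {set F}) :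
  S \subset [set a i | i : 'I_n] -> #|S| = k -> zero_sum S -> NMDS C.
Proof.
move=> SA cS S0.
have [||w [wC w0 wS]] := @prod_XsubC_word (enum S).
- by rewrite -cardE.
- by rewrite big_enum.
pose J := a @^-1: S.
have cJ : #|J| = k.
  rewrite -cS -(card_imset _ a_inj); apply: eq_card => x.
  apply/imsetP/idP => [[i + ->]|xS]; first by rewrite inE.
  by have /imsetP[i _ xE] := subsetP SA _ xS; exists i; rewrite // inE -xE.
have wJ i : i \in J -> w 0 i = 0 by rewrite inE => iS; rewrite wS ?mem_enum.
split; rewrite /AMDS ?dim_dual_code dim_evaluation_code; apply/has_min_distP.
  split; last exact: evaluation_code_weight.
  exists w; split=> //; apply/eqP; rewrite eqn_leq evaluation_code_weight //.
  rewrite andbT leq_subRL ?(ltnW k_lt_n) // -[leqRHS](weight_zeros w).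
  rewrite addnC leq_add2l -cJ.
  by apply/subset_leq_card/subsetP => i iJ; rewrite inE wJ.
(* The dual has dimension [n - k], so its distance must be [n - (n - k) = k]. *)
rewrite subKn ?(ltnW k_lt_n) //.
split; last exact: dual_evaluation_code_weight.
have [|b bD [b0 wb]] := dual_code_low_weight wC w0 _ wJ.
  by rewrite dim_evaluation_code cJ.
exists b; split=> //.
by apply/eqP; rewrite eqn_leq -{1}cJ wb dual_evaluation_code_weight.
Qed.

Lemma AMDS_zero_sum :
  AMDS C ->
  exists S : {set F},
    [/\ S \subset [set a i | i : 'I_n], #|S| = k & zero_sum S].
Proof.
rewrite /AMDS dim_evaluation_code => /has_min_distP[[w [wC w0 ww]] _].
by apply: (evaluation_code_zero_sum wC w0); rewrite ww.
Qed.

End EvaluationCode.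

Theorem proposition2p5 (F : finFieldType) (n k : nat)
    (k_gt0 : (0 < k)%N) (k_lt_n : (k < n)%N)
    (A : {set F}) (a : 'I_n -> F) (a_inj : injective a)
    (defA : A = [set a i | i : 'I_n]) :
  let C := evaluation_code a k (fun=> 1) in
  [/\ MDS C \/ NMDS C,
      MDS C <-> zero_sum_free k A
    & NMDS C <->
        exists S : {set F}, [/\ S \subset A, #|S| = k & zero_sum S]].
Proof.
move=> C; rewrite {A}defA.
have toNMDS : (exists S : {set F},
    [/\ S \subset [set a i | i : 'I_n], #|S| = k & zero_sum S]) -> NMDS C.
  by case=> S [SA cS S0]; apply: NMDS_evaluation_code cS S0.
split.
(* The subsets of [F] are finitely many, so the existence of [S] is decided by a boolean. *)
- have [/existsP[S /and3P[SA /eqP cS /eqP S0]] | noS] :=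
    boolP [exists S : {set F}, [&& S \subset [set a i | i : 'I_n],
                                   #|S| == k & \sum_(x in S) x == 0]].
    by right; apply: toNMDS; exists S.
  left; apply: MDS_evaluation_code => // -[S [SA cS S0]].
  by case/existsP: noS; exists S; rewrite SA cS eqxx; apply/eqP.
(* A zero-sum subset would force the distance [n - k] on an MDS code. *)
- split=> [mC /toNMDS[aC _] | zsf]; first exact: (MDS_not_AMDS mC aC).
  exact: MDS_evaluation_code.
- by split=> // -[aC _]; apply: AMDS_zero_sum aC.
Qed.
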